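(* Let $D=\operatorname{diag}(\lambda_1,\dots,\lambda_n)$ with $\lambda_1>\dots>\lambda_n$, let $\pi\in S_n$, let $\mathfrak p$ be a profile, and let $p$ be a real polynomial. The Toda flow $\dot M=[M,\Pi_{\mathfrak o}\,p(M)]$ leaves the sets $\mathcal U^{\mathbf O}_{D^\pi}\cap V^{\mathcal S}_{\mathfrak p}$ and $\mathcal U^{\mathbf{GL}}_{D^\pi}\cap V^{\mathcal M}_{\mathfrak p}$ invariant, and it linearizes there in the variables $(D^\pi,Z)$ with $Z\in\mathfrak{lo}^0\cap V^{\mathcal M}_{\mathfrak p}$, respectively $(D^\pi,Y,Z)$ with $Y\in\mathfrak{lo}^0$, $Z\in\mathfrak{lo}^0\cap V^{\mathcal M}_{\mathfrak p}$. That is: the variable $Z$ of every matrix in either set belongs to $\mathfrak{lo}^0\cap V^{\mathcal M}_{\mathfrak p}$, and along the flow $\dot D^\pi=0$, $\dot Y=0$ (with $Y=0$ on the first set), $\dot Z=[Z,-p(D^\pi)]$.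
   Context: All matrices are real $n\times n$; $\mathcal M$ is the space of all of them, $\mathcal S\subset\mathcal M$ the symmetric ones, and $[A,B]=AB-BA$. $P_\pi$ is the permutation matrix with $P_\pi e_i=e_{\pi(i)}$, and $D^\pi=P_\pi^\top DP_\pi=\operatorname{diag}(\lambda_{\pi(1)},\dots,\lambda_{\pi(n)})$. $\mathbf{GL}^{\mathrm{pos}}$ and $\mathbf O^{\mathrm{pos}}$ are the sets of invertible, respectively orthogonal, matrices all of whose leading principal minors are positive. $\mathbf{Lo}^1$ is the group of lower triangular matrices with unit diagonal, $\mathfrak{lo}^0$ the strictly lower triangular matrices, $\mathbf{Up}^+$ the upper triangular matrices with positive diagonal. Profiles: given a set $S$ of pairs $(i,j)$, $i\ge j$, $i,j\in\{1,\dots,n\}$, the profile generated by $S$ is $\mathfrak p=\{(i,j) : \exists (i',j')\in S,\ i\le i',\ j\ge j'\}$. $V^{\mathcal M}_{\mathfrak p}\subset\mathcal M$ is the span of the elementary matrices $E_{ij}=e_ie_j^\top$ with $(i,j)\in\mathfrak p$, and $V^{\mathcal S}_{\mathfrak p}=V^{\mathcal M}_{\mathfrak p}\cap\mathcal S$. $\mathcal U^{\mathbf O}_{D^\pi}=\{Q^\top D^\pi Q : Q\in\mathbf O^{\mathrm{pos}}\}$ and $\mathcal U^{\mathbf{GL}}_{D^\pi}=\{X^{-1}D^\pi X : X\in\mathbf{GL}^{\mathrm{pos}}\}$. Linearizing variables: each $M\in\mathcal U^{\mathbf{GL}}_{D^\pi}$ can be written uniquely as $M=Q^\top(Y+D^\pi)Q$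 with $Q\in\mathbf O^{\mathrm{pos}}$, $Y\in\mathfrak{lo}^0$ (and $Y=0$ if $M\in\mathcal U^{\mathbf O}_{D^\pi}$); writing uniquely $Q=LU$ with $L\in\mathbf{Lo}^1$, $U\in\mathbf{Up}^+$, one defines $Z\in\mathfrak{lo}^0$ by $Z+D^\pi=L^{-1}(Y+D^\pi)L$. $\Pi_{\mathfrak o}:\mathcal M\to\mathfrak o$ is the projection associated with the direct sum $\mathcal M=\mathfrak o\oplus\mathfrak{up}$ of skew-symmetric and upper triangular matrices. *)

(* Defs.v *)
From HB Require Import structures.
From mathcomp Require Import all_boot all_order all_algebra all_fingroup.
From mathcomp Require Import all_classical all_reals all_analysis.
Set Implicit Arguments.
Unset Strict Implicit.
Unset Printing Implicit Defensive.
Import Order.TTheory GRing.Theory Num.Theory.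
Import numFieldNormedType.Exports.
Local Open Scope classical_set_scope.
Local Open Scope ring_scope.

(* Rows and columns are numbered from 0. Where p(M) occurs the size is n.+1,
   because [horner_mx] is defined for nonempty square matrices only. *)

Definition lie (R : pzRingType) (n : nat) (A B : 'M[R]_n) : 'M[R]_n :=
  A *m B - B *m A.

(* P_pi e_i = e_(pi i) on column vectors; the entry (i, j) of [perm_mx s] is 1
   iff s i = j, hence the inverse. *)
Definition perm_matrix (R : pzRingType) (n : nat) (pi : 'S_n) : 'M[R]_n :=
  perm_mx (pi^-1)%g.

Definition diag_perm (R : pzRingType) (n : nat) (lam : 'rV[R]_n) (pi : 'S_n) :
    'M[R]_n :=
  (perm_matrix R pi)^T *m diag_mx lam *m perm_matrix R pi.

Lemma diag_permE (R : pzRingType) (n : nat) (lam : 'rV[R]_n) (pi : 'S_n) :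
  diag_perm lam pi = diag_mx (\row_i lam 0 (pi i)).
Proof.
rewrite /diag_perm /perm_matrix tr_perm_mx invgK -row_permE -{2}(invgK pi).
rewrite -col_permE invgK; apply/matrixP => i j.
by rewrite !mxE (inj_eq perm_inj).
Qed.

Definition decreasing_row (R : realType) (n : nat) (lam : 'rV[R]_n) : Prop :=
  forall i j : 'I_n, (i < j)%N -> lam 0 j < lam 0 i.

(* The index k : 'I_n stands for the leading minor of size k.+1. *)
Definition lead_minors_pos (R : realType) (n : nat) (A : 'M[R]_n) : Prop :=
  forall k : 'I_n,
    0 < \det (mxsub (widen_ord (ltn_ord k)) (widen_ord (ltn_ord k)) A).

Definition GLpos (R : realType) (n : nat) : set 'M[R]_n :=
  [set A | A \in unitmx /\ lead_minors_pos A].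

Definition Opos (R : realType) (n : nat) : set 'M[R]_n :=
  [set A | A^T *m A = 1%:M /\ lead_minors_pos A].

Definition Lo1 (R : realType) (n : nat) : set 'M[R]_n :=
  [set A | is_trig_mx A /\ forall i, A i i = 1].

Definition lo0 (R : realType) (n : nat) : set 'M[R]_n :=
  [set A | forall i j : 'I_n, (i <= j)%N -> A i j = 0].

Definition Uppos (R : realType) (n : nat) : set 'M[R]_n :=
  [set A | is_trig_mx A^T /\ forall i, 0 < A i i].

Definition gen_profile (n : nat) (S : {set 'I_n * 'I_n}) : {set 'I_n * 'I_n} :=
  [set x : 'I_n * 'I_n |
    [exists y in S, ((x.1 <= y.1) && (y.2 <= x.2))%N]]%SET.

Definition is_profile (n : nat) (P : {set 'I_n * 'I_n}) : Prop :=
  exists2 S : {set 'I_n * 'I_n},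
    (forall y, y \in S -> (y.2 <= y.1)%N) & P = gen_profile S.

Definition VM (R : realType) (n : nat) (P : {set 'I_n * 'I_n}) :
    set 'M[R]_n :=
  [set M | M \in <<[seq delta_mx x.1 x.2 | x in P]>>%VS].

Definition VS (R : realType) (n : nat) (P : {set 'I_n * 'I_n}) :
    set 'M[R]_n :=
  VM P `&` [set M | M^T = M].

Definition UO (R : realType) (n : nat) (D : 'M[R]_n) : set 'M[R]_n :=
  [set M | exists2 Q, Opos Q & M = Q^T *m D *m Q].

Definition UGL (R : realType) (n : nat) (D : 'M[R]_n) : set 'M[R]_n :=
  [set M | exists2 X, GLpos X & M = invmx X *m D *m X].

Definition sym_part (R : realType) (n : nat) (A : 'M[R]_n) : 'M[R]_n := A + A^T.

Lemma sym_part_is_linear (R : realType) (n : nat) :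
  linear (@sym_part R n).
Proof.
move=> a A B; rewrite /sym_part linearD linearZ /= scalerDr.
by rewrite addrACA.
Qed.

HB.instance Definition _ (R : realType) (n : nat) :=
  GRing.isLinear.Build R 'M[R]_n 'M[R]_n _ (@sym_part R n)
    (@sym_part_is_linear R n).

Definition skew_space (R : realType) (n : nat) : {vspace 'M[R]_n} :=
  lker (linfun (@sym_part R n)).

Definition up_space (R : realType) (n : nat) : {vspace 'M[R]_n} :=
  <<[seq delta_mx x.1 x.2 | x in [set x : 'I_n * 'I_n | (x.1 <= x.2)%N]%SET]>>%VS.

Definition Pi_o (R : realType) (n : nat) : 'M[R]_n -> 'M[R]_n :=
  daddv_pi (skew_space R n) (up_space R n).

Lemma mem_skew_space (R : realType) (n : nat) (A : 'M[R]_n) :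
  (A \in skew_space R n) = (A^T == - A).
Proof. by rewrite memv_ker lfunE /= /sym_part addrC addr_eq0. Qed.

Lemma mem_span_delta (R : realType) (n : nat) (P : {set 'I_n * 'I_n})
    (A : 'M[R]_n) :
  A \in <<[seq delta_mx x.1 x.2 | x in P]>>%VS <->
  forall i j, (i, j) \notin P -> A i j = 0.
Proof.
split=> [/coord_span -> i j ijP | A0].
  rewrite summxE big1 // => k _; rewrite mxE.
  have : [tuple of [seq delta_mx x.1 x.2 | x in P]]`_k
           \in [seq (delta_mx x.1 x.2 : 'M[R]_n) | x in P].
    by rewrite mem_nth // size_tuple.
  move=> /mapP[x xP ->]; rewrite mxE; case: andP => [[/eqP ei /eqP ej]|_].
    by move: xP; rewrite mem_enum (surjective_pairing x) -ei -ej (negbTE ijP).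
  by rewrite mulr0.
rewrite (matrix_sum_delta A); apply: memv_suml => i _; apply: memv_suml => j _.
have [ijP|/A0 ->] := boolP ((i, j) \in P); last by rewrite scale0r mem0v.
by apply/memvZ/memv_span/mapP; exists (i, j); rewrite ?mem_enum.
Qed.

Lemma Pi_oE (R : realType) (n : nat) (A : 'M[R]_n) :
  Pi_o A = \matrix_(i, j)
    if (j < i)%N then A i j else if (i < j)%N then - A j i else 0.
Proof.
set K := (X in _ = X).
have upP (B : 'M[R]_n) : reflect (forall i j : 'I_n, (j < i)%N -> B i j = 0)
                     (B \in up_space R n).
  apply: (iffP idP) => [/mem_span_delta B0 i j ji | B0].
    by apply: B0; rewrite inE -ltnNge.
  by apply/mem_span_delta => i j; rewrite inE /= -ltnNge; exact: B0.
have Kskew : K \in skew_space R n.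
  rewrite mem_skew_space; apply/eqP/matrixP => i j; rewrite !mxE.
  by case: ltngtP => _; rewrite ?opprK ?oppr0.
have AKup : A - K \in up_space R n.
  by apply/upP => i j ji; rewrite !mxE ji subrr.
have cap0 : (skew_space R n :&: up_space R n = 0)%VS.
  apply/eqP; rewrite -subv0; apply/subvP => B.
  rewrite memv_cap mem_skew_space memv0 => /andP[/eqP skB /upP B0].
  have skE i j : B j i = - B i j by have /matrixP/(_ i j) := skB; rewrite !mxE.
  apply/eqP/matrixP => i j; rewrite mxE; case: (ltngtP i j) => [ij|/B0//|ij].
    by rewrite skE B0 ?oppr0.
  have -> : j = i by apply/val_inj.
  by apply/eqP; rewrite -[_ == 0](mulrn_eq0 _ 2) mulr2n {1}skE addNr.
rewrite /Pi_o -{1}(subrK K A) linearD /= (daddv_pi_id cap0 Kskew).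
suff -> : daddv_pi (skew_space R n) (up_space R n) (A - K) = 0 by rewrite add0r.
have cap0' : (up_space R n :&: skew_space R n = 0)%VS by rewrite capvC.
have := daddv_pi_add cap0 (subvP (addvSr (skew_space R n) (up_space R n)) _ AKup).
rewrite (daddv_pi_id cap0' AKup) => /(canRL (addrK _)) ->.
by rewrite subrr.
Qed.

Definition toda_solution (R : realType) (n : nat) (p : {poly R})
    (J : set R) (M : R -> 'M[R]_n.+1) : Prop :=
  forall t : R, J t ->
    is_derive t (1 : R) M (lie (M t) (Pi_o (horner_mx (M t) p))).

Definition toda_invariant (R : realType) (n : nat) (p : {poly R})
    (A : set 'M[R]_n.+1) : Prop :=
  forall (J : set R) (M : R -> 'M[R]_n.+1),
    open J -> is_interval J -> toda_solution p J M ->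
    forall s t : R, J s -> J t -> A (M s) -> A (M t).

(* (Dpi, Y, Z) are the linearizing variables of M in the chart pi. The diagonal
   part is itself a variable: it ranges over all D'^pi with D' = diag(lam),
   lam strictly decreasing. *)
Definition lin_vars (R : realType) (n : nat) (pi : 'S_n)
    (M Dpi Y Z : 'M[R]_n) : Prop :=
  (exists2 lam : 'rV[R]_n, decreasing_row lam & Dpi = diag_perm lam pi) /\
  lo0 Y /\ lo0 Z /\
  exists Q L U : 'M[R]_n,
    [/\ Opos Q, M = Q^T *m (Y + Dpi) *m Q,
        [/\ Lo1 L, Uppos U & Q = L *m U] &
        Z + Dpi = invmx L *m (Y + Dpi) *m L].

Definition lin_vars_defined (R : realType) (n : nat) (pi : 'S_n)
    (A : set 'M[R]_n) : Prop :=
  forall M, A M ->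
    exists! v : 'M[R]_n * 'M[R]_n * 'M[R]_n, lin_vars pi M v.1.1 v.1.2 v.2.

Definition toda_linear (R : realType) (n : nat) (p : {poly R})
    (pi : 'S_n.+1) (A : set 'M[R]_n.+1) : Prop :=
  forall (J : set R) (M Dpi Y Z : R -> 'M[R]_n.+1),
    open J -> is_interval J -> toda_solution p J M ->
    (forall t, J t -> A (M t)) ->
    (forall t, J t -> lin_vars pi (M t) (Dpi t) (Y t) (Z t)) ->
    forall t : R, J t ->
      [/\ is_derive t (1 : R) Dpi 0, is_derive t (1 : R) Y 0 &
          is_derive t (1 : R) Z (lie (Z t) (- horner_mx (Dpi t) p))].

(* Main.v *)
(** Write [A] for the upper triangular part of [p(M)], i.e. [p(M) = Pi_o p(M) + A].
    As [M] commutes with [p(M)], the flow is also [M' = A M - M A], so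
    [M(t) = U^-1 M(s) U], where [U' = - U A], [U(s) = 1]. This linear system is
    triangular, hence solved by quadratures, and [U] stays upper triangular with
    positive diagonal; such conjugations preserve profiles. With
    [F = exp ((t - s) p(M(s)))] the matrix [O = F U] satisfies [O' = O Pi_o p(M)],
    so it is orthogonal. If [M(s) = Q0^T (Y + D) Q0], [Q0 = L0 U0] and
    [K = exp ((t - s) p(Y + D))], which is lower triangular, then [Q0 O = K Q0 U]
    shows that [M(t) = Q^T (Y + D) Q] with the same [Y], and
    [Q = (K L0 E^-1) (E U0 U)] with [E = exp ((t - s) p(D))] gives
    [Z(t) = E Z(s) E^-1].
    Uniqueness of the variables: if [Q] and [Q'] represent the same matrix,
    [Q' Q^T] intertwines two lower triangular matrices with the same simple
    diagonal, so it is lower triangular; being orthogonal with positive leading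
    minors it is the identity. *)
Require Import Defs.
From mathcomp Require Import all_boot all_order all_algebra all_fingroup.
From mathcomp Require Import all_classical all_reals all_analysis.
From mathcomp Require Import ring.
Set Implicit Arguments.
Unset Strict Implicit.
Unset Printing Implicit Defensive.
Import Order.TTheory GRing.Theory Num.Theory.
Import numFieldNormedType.Exports.
Local Open Scope classical_set_scope.
Local Open Scope ring_scope.

(** * Lower triangular matrices: products, inverses and eigenvalues *)

Section Triangular.
Variables (F : fieldType) (n : nat).
Implicit Types A B L U : 'M[F]_n.

Lemma trig_mulE A B i j : is_trig_mx A ->
  (A *m B) i j = \sum_(k < n | (k <= i)%N) A i k * B k j.
Proof.
move=> /is_trig_mxP A0; rewrite mxE [RHS]big_mkcond; apply: eq_bigr => k _.
by case: leqP => // /A0 ->; rewrite mul0r.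
Qed.

Lemma trig_mul A B : is_trig_mx A -> is_trig_mx B -> is_trig_mx (A *m B).
Proof.
move=> At /is_trig_mxP B0; apply/is_trig_mxP => i j ij.
by rewrite trig_mulE// big1// => k ki; rewrite B0 ?mulr0// (leq_ltn_trans ki).
Qed.

Lemma trig_mul_diag A B i : is_trig_mx A -> is_trig_mx B ->
  (A *m B) i i = A i i * B i i.
Proof.
move=> At /is_trig_mxP B0; rewrite trig_mulE// (bigD1 i)//= big1 ?addr0// => k.
by case/andP=> ki kNi; rewrite B0 ?mulr0// ltn_neqAle ki andbT.
Qed.

Lemma trig_unitmxP A : is_trig_mx A ->
  reflect (forall i, A i i != 0) (A \in unitmx).
Proof.
move=> At; rewrite unitmxE det_trig// unitfE.
by apply: (iffP idP) => [/prodf_neq0 A0 i|A0]; [exact: A0|exact/prodf_neq0].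
Qed.

(** Strong induction on the row [i]: in entry [(i, j)] of [A A^-1 = 1] with [i < j], the terms of
    index below [i] vanish by induction, and [A i i] is nonzero. *)
Lemma trig_inv A : A \in unitmx -> is_trig_mx A -> is_trig_mx (invmx A).
Proof.
move=> Au At; apply/is_trig_mxP => i j.
have [k] := ubnP i; elim: k i => // k IH i ik ij.
have /matrixP/(_ i j) := mulmxV Au; rewrite trig_mulE// (bigD1 i)//=.
rewrite big1 => [|l /andP[li lNi]]; last first.
  have {}li : (l < i)%N by rewrite ltn_neqAle lNi.
  by rewrite IH ?mulr0 ?(leq_trans li)// ltnW.
rewrite addr0 mxE -val_eqE ltn_eqF// => /eqP; rewrite mulf_eq0.
by rewrite (negPf (trig_unitmxP At Au i)) => /eqP.
Qed.

Lemma trig_inv_diag A i : A \in unitmx -> is_trig_mx A ->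
  invmx A i i = (A i i)^-1.
Proof.
move=> Au At; have A0 := trig_unitmxP At Au i.
have := trig_mul_diag i At (trig_inv Au At).
by rewrite mulmxV// mxE eqxx => /(canLR (mulKf A0)) <-; rewrite mulr1.
Qed.

Lemma trig_tr_trig A : is_trig_mx A -> is_trig_mx A^T -> is_diag_mx A.
Proof.
move=> /is_trig_mxP At /is_trig_mxP Au; apply/is_diag_mxP => i j.
by case: ltngtP => // [/At //|/Au]; rewrite mxE.
Qed.

(** Entry [(i, j)] of the relation reads [A i j (d_j - d_i) = 0]. *)
Lemma comm_diag_is_diag (d : 'rV[F]_n) A : injective (d 0) ->
  A *m diag_mx d = diag_mx d *m A -> is_diag_mx A.
Proof.
move=> dI /matrixP AD; apply/is_diag_mxP => i j ij.
have /eqP := AD i j; rewrite mul_mx_diag mul_diag_mx !mxE mulrC -subr_eq0.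
rewrite -mulrBl mulf_eq0 subr_eq0 => /predU1P[/dI ji|/eqP//].
by rewrite ji eqxx in ij.
Qed.

Lemma trig_eigenvalueP A (a : F) : is_trig_mx A ->
  reflect (exists i, A i i = a) (eigenvalue A a).
Proof.
move=> At; rewrite eigenvalue_root_char char_poly_trig//.
rewrite -(big_map (fun i => A i i) xpredT (fun x => 'X - x%:P)) root_prod_XsubC.
by apply: (iffP mapP) => [[i _ ->]|[i <-]]; exists i; rewrite ?mem_index_enum.
Qed.

(** Eigenvectors are rows here: [v B = a v] gives [(v W) A = a (v W)], and [v W] is nonzero because
    [W] is invertible. *)
Lemma intertwine_eigenvalue A B W a : W \in unitmx -> W *m A = B *m W ->
  eigenvalue B a -> eigenvalue A a.
Proof.
move=> Wu WA /eigenvalueP[v vB v0]; apply/eigenvalueP; exists (v *m W).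
  by rewrite -mulmxA WA mulmxA vB scalemxAl.
by apply: contra v0 => /eqP vW; rewrite -[v](mulmxK Wu) vW mul0mx.
Qed.

End Triangular.

(** * Leading principal minors *)

Section LeadingMinors.
Variables (R : realType) (n : nat).
Implicit Types A B L U : 'M[R]_n.

(** The block occurring in [lead_minors_pos], named so that it can be folded and rewritten. *)
Definition lead_sub (k : 'I_n) A : 'M[R]_k.+1 :=
  mxsub (widen_ord (ltn_ord k)) (widen_ord (ltn_ord k)) A.

(** The first [k.+1] rows of [L] vanish beyond column [k], so the sums in the product stop there. *)
Lemma lead_sub_mull k L A : is_trig_mx L ->
  lead_sub k (L *m A) = lead_sub k L *m lead_sub k A.
Proof.
move=> Lt; apply/matrixP => i j; rewrite [LHS]mxE trig_mulE//.
have /is_trig_mxP L0 := Lt; rewrite big_mkcond mxE.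
rewrite [RHS](eq_bigr (fun l => L (widen_ord (ltn_ord k) i)
  (widen_ord (ltn_ord k) l) * A (widen_ord (ltn_ord k) l)
  (widen_ord (ltn_ord k) j))) => [|l _]; last by rewrite !mxE.
pose G l := L (widen_ord (ltn_ord k) i) l * A l (widen_ord (ltn_ord k) j).
(* [H] extends [G] by zero to all natural numbers, so that sums over ['I_n] and ['I_k.+1] share one
   summand. *)
pose H (l : nat) := if insub l is Some l' then G l' else 0.
transitivity (\sum_(l < n) H l).
  apply: eq_bigr => l _; rewrite /H valK; case: leqP => // /L0 Lil.
  by rewrite /G Lil mul0r.
transitivity (\sum_(l < k.+1) H l); last first.
  apply: eq_bigr => l _; rewrite /H.
  by rewrite [in insub _](_ : l = widen_ord (ltn_ord k) l :> nat)// valK.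
rewrite (big_ord_widen _ H (ltn_ord k)) [RHS]big_mkcond; apply: eq_bigr => l _.
case: ltnP => // kl; rewrite /H valK /G L0 ?mul0r//=.
exact: leq_trans (ltn_ord i) kl.
Qed.

Lemma det_lead_sub_mull k L A : is_trig_mx L ->
  \det (lead_sub k (L *m A)) = \det (lead_sub k L) * \det (lead_sub k A).
Proof. by move=> Lt; rewrite lead_sub_mull// det_mulmx. Qed.

Lemma det_lead_sub_tr k A : \det (lead_sub k A^T) = \det (lead_sub k A).
Proof. by rewrite -det_tr; congr (\det _); apply/matrixP => i j; rewrite !mxE. Qed.

Lemma det_lead_sub_trig k L : is_trig_mx L ->
  \det (lead_sub k L) =
  \prod_(i < k.+1) L (widen_ord (ltn_ord k) i) (widen_ord (ltn_ord k) i).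
Proof.
move=> /is_trig_mxP L0; rewrite det_trig.
  by apply: eq_bigr => i _; rewrite mxE.
by apply/is_trig_mxP => i j ij; rewrite mxE L0.
Qed.

(** Each leading minor is the previous one times the next diagonal entry. *)
Lemma trig_lead_minors_pos L : is_trig_mx L ->
  lead_minors_pos L <-> forall i, 0 < L i i.
Proof.
move=> Lt; split=> [Lp i|Lp k]; last first.
  by rewrite -/(lead_sub k L) det_lead_sub_trig// prodr_gt0.
have [k] := ubnP i; elim: k i => // k IH i ik.
have := Lp i; rewrite -/(lead_sub i L) det_lead_sub_trig// big_ord_recr/=.
rewrite pmulr_rgt0; last first.
  by apply: prodr_gt0 => j _; apply: IH => /=; exact: leq_trans (ltn_ord j) ik.
by congr (0 < L _ _); apply/val_inj.
Qed.

Lemma lead_minors_pos_tr A : lead_minors_pos A^T <-> lead_minors_pos A.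
Proof.
by split=> H k; have := H k; rewrite -!/(lead_sub k _) det_lead_sub_tr.
Qed.

Lemma lead_minors_pos_mull L A : is_trig_mx L -> lead_minors_pos A ->
  lead_minors_pos (L *m A) <-> lead_minors_pos L.
Proof.
move=> Lt Ap; split=> H k; have := H k; have := Ap k;
  rewrite -!/(lead_sub k _) det_lead_sub_mull// => Apk.
- by rewrite pmulr_lgt0.
- by move=> Lpk; rewrite mulr_gt0.
Qed.

Lemma lead_minors_pos_mulr A U : is_trig_mx U^T -> lead_minors_pos A ->
  lead_minors_pos (A *m U) <-> lead_minors_pos U.
Proof.
move=> Ut /lead_minors_pos_tr Ap; rewrite -lead_minors_pos_tr trmx_mul.
by rewrite lead_minors_pos_mull// lead_minors_pos_tr.
Qed.

Lemma lower_elimination A : (forall k, lead_sub k A \in unitmx) ->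
  exists2 N, is_trig_mx N & is_trig_mx (N *m A)^T /\ forall i, (N *m A) i i = 1.
Proof.
move=> Au.
(* Row [i] of [N] is the last row of the inverse of the leading block of size
   [i.+1], padded by zeros. *)
pose y (i : 'I_n) := row ord_max (invmx (lead_sub i A)).
pose N : 'M[R]_n := \matrix_(i, j) if (j <= i)%N then y i 0 (inord j) else 0.
have Nt : is_trig_mx N by apply/is_trig_mxP => i j ij; rewrite mxE leqNgt ij.
have eM (i : 'I_n) : widen_ord (ltn_ord i) ord_max = i by exact/val_inj.
have NE (i : 'I_n) l : lead_sub i N ord_max l = y i 0 l.
  by rewrite mxE eM mxE/= -ltnS ltn_ord inord_val.
(* Row [i] of [N A], cut after column [i], is the last row of the inverse block times the block,
   hence the last unit vector. *)
have NA (i : 'I_n) (j : 'I_i.+1) :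
    (N *m A) i (widen_ord (ltn_ord i) j) = (j == ord_max)%:R.
  have /matrixP/(_ ord_max j) := mulVmx (Au i); rewrite [RHS]mxE eq_sym => <-.
  have /matrixP/(_ ord_max j) := lead_sub_mull i A Nt; rewrite mxE eM => ->.
  by rewrite !mxE; apply: eq_bigr => l _; rewrite NE mxE.
exists N => //; split=> [|i].
  apply/is_trig_mxP => i j ij; rewrite mxE.
  have ij' : (i < j.+1)%N by exact: ltnW.
  have -> : i = widen_ord (ltn_ord j) (Ordinal ij') by exact/val_inj.
  by rewrite NA -val_eqE/= ltn_eqF.
by have := NA i ord_max; rewrite eM eqxx.
Qed.
End LeadingMinors.

(** * Triangular and orthogonal factorizations; diagonalization by triangular matrices *)

Section Factorizations.
Variables (R : realType) (n : nat).
Implicit Types A L U Q W X : 'M[R]_n.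

Lemma Lo1_unitmx L : Lo1 L -> L \in unitmx.
Proof.
by case=> Lt L1; apply/(trig_unitmxP Lt) => i; rewrite L1 oner_neq0.
Qed.

Lemma trig_pos_unitmx L : is_trig_mx L -> (forall i, 0 < L i i) -> L \in unitmx.
Proof. by move=> Lt L0; apply/(trig_unitmxP Lt) => i; rewrite gt_eqF. Qed.

Lemma Uppos_unitmx U : Uppos U -> U \in unitmx.
Proof.
by case=> Ut U0; rewrite -unitmx_tr trig_pos_unitmx// => i; rewrite mxE.
Qed.

Lemma Uppos_mul U V : Uppos U -> Uppos V -> Uppos (U *m V).
Proof.
move=> [Ut U0] [Vt V0]; split=> [|i]; first by rewrite trmx_mul trig_mul.
suff -> : (U *m V) i i = U i i * V i i by rewrite mulr_gt0.
have := trig_mul_diag i Vt Ut.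
by rewrite -trmx_mul !mxE mulrC.
Qed.

Lemma diag_Uppos (d : 'rV[R]_n) : (forall i, 0 < d 0 i) -> Uppos (diag_mx d).
Proof.
by move=> d0; split=> [|i]; rewrite ?tr_diag_mx ?diag_mx_is_trig// mxE eqxx mulr1n.
Qed.

Lemma Uppos_lead_minors_pos U : Uppos U -> lead_minors_pos U.
Proof.
case=> Ut U0; apply/lead_minors_pos_tr/(trig_lead_minors_pos Ut) => i.
by rewrite mxE.
Qed.

Lemma Opos_unitmx Q : Opos Q -> Q \in unitmx.
Proof. by case=> /mulmx1_unit[]. Qed.

Lemma ortho_invmx Q : Q^T *m Q = 1%:M -> invmx Q = Q^T.
Proof.
by move=> QQ; have [_ Qu] := mulmx1_unit QQ; rewrite -[RHS](mulmxK Qu) QQ mul1mx.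
Qed.

(** The inverse of [W] is its transpose, so [W] is both lower and upper triangular, hence diagonal;
    its entries are positive with square 1. *)
Lemma ortho_trig_pos W : is_trig_mx W -> (forall i, 0 < W i i) ->
  W^T *m W = 1%:M -> W = 1%:M.
Proof.
move=> Wt W0 WW; have Wu := trig_pos_unitmx Wt W0.
have WTt : is_trig_mx W^T by rewrite -(ortho_invmx WW) trig_inv.
have /is_diag_mxP Wd := trig_tr_trig Wt WTt.
apply/matrixP => i j; rewrite [RHS]mxE; case: eqVneq => [<-{j}|ij]; last exact: Wd.
have /matrixP/(_ i i) := WW; rewrite trig_mul_diag// !mxE eqxx => /eqP.
by rewrite -expr2 sqrf_eq1 => /orP[/eqP//|/eqP Wi]; have := W0 i; rewrite Wi ltr0N1.
Qed.

(** The matrix [L'^-1 L = U' U^-1] is lower and upper triangular with unit diagonal. *)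
Lemma Lo1_Uppos_uniq L L' U U' : Lo1 L -> Lo1 L' -> Uppos U -> Uppos U' ->
  L *m U = L' *m U' -> L = L'.
Proof.
move=> L1 L1' Up Up' LU.
have [Lu Lu'] := (Lo1_unitmx L1, Lo1_unitmx L1').
have [Uu Uu'] := (Uppos_unitmx Up, Uppos_unitmx Up').
pose W := invmx L' *m L.
have WE : W = U' *m invmx U by rewrite /W -[L](mulmxK Uu) LU mulmxA mulKmx.
have [[Lt Ld] [Lt' Ld']] := (L1, L1').
have Wt : is_trig_mx W by rewrite trig_mul// trig_inv.
have WTt : is_trig_mx W^T.
  rewrite WE trmx_mul trmx_inv trig_mul ?trig_inv ?unitmx_tr//; first by case: Up.
  by case: Up'.
have /is_diag_mxP Wd := trig_tr_trig Wt WTt.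
suff W1 : W = 1%:M by rewrite -[L](mulKVmx Lu') -/W W1 mulmx1.
apply/matrixP => i j; rewrite [RHS]mxE; case: eqVneq => [<-{j}|ij]; last exact: Wd.
by rewrite /W trig_mul_diag ?trig_inv// trig_inv_diag// Ld Ld' invr1 mulr1.
Qed.

(** Elimination makes [N A] upper triangular with unit diagonal. As the minors of [A] and [N A] are
    positive, so is the diagonal of [N]; rescaling the columns of [N^-1] by it gives [L]. *)
Lemma Lo1_Uppos_exists A : lead_minors_pos A ->
  exists L U, [/\ Lo1 L, Uppos U & A = L *m U].
Proof.
move=> Ap; have [k|N Nt [Vt V1]] := @lower_elimination R n A.
  by rewrite unitmxE unitfE gt_eqF.
have V1' i : (N *m A)^T i i = 1 by rewrite mxE.
have Vp : lead_minors_pos (N *m A).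
  by apply: Uppos_lead_minors_pos; split=> // i; rewrite V1.
have /(trig_lead_minors_pos Nt) N0 := (lead_minors_pos_mull Nt Ap).1 Vp.
have Nu := trig_pos_unitmx Nt N0.
pose e := \row_i N i i; have e0 i : 0 < e 0 i by rewrite mxE.
have eU := diag_Uppos e0; have eu := Uppos_unitmx eU.
have et := diag_mx_is_trig e.
exists (invmx N *m diag_mx e), (invmx (diag_mx e) *m (N *m A)); split.
- split=> [|i]; first by rewrite trig_mul// trig_inv.
  by rewrite trig_mul_diag ?trig_inv// trig_inv_diag// !mxE eqxx mulr1n mulVf// gt_eqF.
- have it : is_trig_mx (invmx (diag_mx e))^T.
    by rewrite trmx_inv tr_diag_mx trig_inv.
  apply: Uppos_mul; split=> // i; last by rewrite V1.
  by rewrite trig_inv_diag// mxE eqxx mulr1n invr_gt0.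
- by rewrite mulmxA mulmxK// mulKmx.
Qed.

Lemma row_sqr_eq0 m (u : 'rV[R]_m) : u *m u^T = 0 -> u = 0.
Proof.
move=> /matrixP/(_ 0 0); rewrite !mxE => u0; apply/rowP => j; rewrite mxE.
have H (i : 'I_m) : true -> 0 <= u 0 i * u^T i 0.
  by rewrite mxE -expr2 sqr_ge0.
by have /eqP := psumr_eq0P H u0 (i := j) isT; rewrite mxE -expr2 sqrf_eq0 => /eqP.
Qed.

(** The block is the Gram matrix of the first rows of [X]: if [v] is in its kernel, the combination
    of these rows with coefficients [v] has length zero, and the rows are independent. *)
Lemma lead_sub_gram_unitmx X k : X \in unitmx -> lead_sub k (X *m X^T) \in unitmx.
Proof.
move=> Xu; set f := widen_ord (ltn_ord k); rewrite -row_free_unit.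
have fI : injective f by move=> i j /(congr1 val) /= ij; apply/val_inj.
apply: inj_row_free => v.
rewrite /lead_sub mxsub_mul => /(congr1 (mulmx^~ v^T)).
have -> : colsub (widen_ord (ltn_ord k)) X^T = (rowsub f X)^T.
  by apply/matrixP => i j; rewrite !mxE.
rewrite mul0mx mulmxA -mulmxA -trmx_mul => /row_sqr_eq0 vX.
have vf : v *m rowsub f 1%:M = 0 :> 'rV[R]_n.
  apply: (can_inj (mulmxK Xu)); rewrite mul0mx -vX -mulmxA; congr (_ *m _).
  by rewrite mul_rowsub_mx mul1mx.
apply/rowP => j; have /rowP/(_ (f j)) := vf; rewrite !mxE => <-.
rewrite (bigD1 j)//= !mxE eqxx mulr1 big1 ?addr0// => i ij.
by rewrite !mxE (inj_eq fI) (negPf ij) mulr0.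
Qed.

Lemma lower_orthogonal_exists X : X \in unitmx ->
  exists T Q, [/\ is_trig_mx T, forall i, 0 < T i i, Q^T *m Q = 1%:M & X = T *m Q].
Proof.
(* Gram-Schmidt via elimination on the Gram matrix: [N X] has orthogonal rows. *)
move=> Xu; have [k|N Nt [Vt V1]] := @lower_elimination R n (X *m X^T).
  exact: lead_sub_gram_unitmx.
have Nu : N \in unitmx.
  have : N *m (X *m X^T) \in unitmx.
    rewrite -unitmx_tr; apply/(trig_unitmxP Vt) => i.
    by rewrite mxE V1 oner_neq0.
  by rewrite unitmx_mul => /andP[].
have [S SE] : exists S, S = N *m X by exists (N *m X).
have SS : S *m S^T = N *m (X *m X^T) *m N^T by rewrite SE trmx_mul !mulmxA.
(* [S S^T] is a product of the upper triangular matrices [N X X^T] and [N^T]; being symmetric, it is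
   diagonal. *)
have SSt : is_trig_mx (S *m S^T).
  have -> : S *m S^T = (S *m S^T)^T by rewrite trmx_mul trmxK.
  by rewrite SS trmx_mul trmxK trig_mul.
have /is_diag_mxP SSd : is_diag_mx (S *m S^T).
  by apply: trig_tr_trig; rewrite // trmx_mul trmxK.
have SSi i : (S *m S^T) i i = N i i.
  have -> : (S *m S^T) i i = (N *m (N *m (X *m X^T))^T) i i.
    have -> : N *m (N *m (X *m X^T))^T = (S *m S^T)^T.
      by rewrite SS !trmx_mul !trmxK.
    by rewrite [RHS]mxE.
  by rewrite trig_mul_diag// mxE V1 mulr1.
have N0 i : 0 < N i i.
  rewrite lt_def (trig_unitmxP Nt Nu)/= -SSi mxE sumr_ge0// => j _.
  by rewrite mxE -expr2 sqr_ge0.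
(* Row [i] of [S] has squared length [N i i], so [c] normalizes the rows. *)
pose c := \row_i (Num.sqrt (N i i))^-1; have c0 i : 0 < c 0 i.
  by rewrite mxE invr_gt0 sqrtr_gt0.
have ct := diag_mx_is_trig c.
have cNt : is_trig_mx (diag_mx c *m N) by rewrite trig_mul.
have cN0 i : 0 < (diag_mx c *m N) i i.
  by rewrite trig_mul_diag// mxE eqxx mulr1n mulr_gt0.
have cNu := trig_pos_unitmx cNt cN0.
exists (invmx (diag_mx c *m N)), (diag_mx c *m S); split.
- by rewrite trig_inv.
- by move=> i; rewrite trig_inv_diag// invr_gt0.
- apply: mulmx1C; rewrite trmx_mul tr_diag_mx mulmxA -(mulmxA _ S).
  apply/matrixP => i j; rewrite mul_mx_diag mxE mul_diag_mx mxE [RHS]mxE.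
  case: eqVneq => [<-{j}|ij]; last by rewrite SSd// mulr0 mul0r.
  rewrite SSi !mxE mulrAC -invfM -expr2 sqr_sqrtr ?ltW// mulVf//.
  by rewrite gt_eqF.
- by rewrite SE (mulmxA _ N) mulKmx.
Qed.

(** The rows of [P] are left eigenvectors of [T], one for each diagonal entry, scaled to have 1 on
    the diagonal. *)
Lemma trig_diagonalizer (T : 'M[R]_n) (d : 'rV[R]_n) : is_trig_mx T ->
  (forall i, T i i = d 0 i) -> injective (d 0) ->
  exists2 P, Lo1 P & P *m T = diag_mx d *m P.
Proof.
move=> Tt Td dI.
have /fin_all_exists[v vP] (i : 'I_n) : exists v : 'rV[R]_n,
    [/\ v *m T = d 0 i *: v, v 0 i = 1 & forall j : 'I_n, (i < j)%N -> v 0 j = 0].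
  have /eigenvalueP[v vT /rV0Pn[k0 vk0]] : eigenvalue T (d 0 i).
    by apply/(trig_eigenvalueP _ Tt); exists i.
  (* The last nonzero entry of the left eigenvector [v] sits at the index of
     its eigenvalue on the diagonal. *)
  have [m vm mmax] := @arg_maxnP _ k0 (fun k => v 0 k != 0) (@nat_of_ord n) vk0.
  have v0 (j : 'I_n) : (m < j)%N -> v 0 j = 0.
    by move=> mj; apply/eqP; apply: contraTT mj => /mmax jm; rewrite -leqNgt.
  have mi : m = i.
    have /rowP/(_ m) := vT; rewrite !mxE (bigD1 m)//= big1 ?addr0 => [|k km].
      by rewrite Td mulrC => /(mulIf vm)/dI.
    case: (ltngtP k m) => [km'|/v0 ->|/val_inj kme]; last by rewrite kme eqxx in km.
      by have /is_trig_mxP -> := Tt; rewrite ?mulr0.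
    by rewrite mul0r.
  exists ((v 0 m)^-1 *: v); split=> [||j ij].
  - by rewrite -scalemxAl vT !scalerA mulrC.
  - by rewrite mxE -mi mulVf.
  - by rewrite mxE (v0 j) ?mi// mulr0.
exists (\matrix_i v i).
  split=> [|i]; last by have [_ vi _] := vP i; rewrite mxE.
  by apply/is_trig_mxP => i j ij; have [_ _ vi] := vP i; rewrite mxE vi.
apply/row_matrixP => i; have [vi _ _] := vP i.
by rewrite !row_mul rowK vi row_diag_mx -scalemxAl -rowE rowK.
Qed.

(** Diagonalizing [T] and [T'] by lower triangular [P] and [P'] turns [W] into [P' W P^-1], which
    commutes with a simple diagonal matrix and is therefore diagonal. *)
Lemma trig_intertwine (T T' W : 'M[R]_n) (d : 'rV[R]_n) : injective (d 0) ->
  is_trig_mx T -> is_trig_mx T' -> (forall i, T i i = d 0 i) ->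
  (forall i, T' i i = d 0 i) -> W *m T = T' *m W -> is_trig_mx W.
Proof.
move=> dI Tt Tt' Td Td' WT.
have [P P1 PT] := trig_diagonalizer Tt Td dI.
have [P' P1' PT'] := trig_diagonalizer Tt' Td' dI.
have [[Pt _] [Pt' _]] := (P1, P1').
have [Pu Pu'] := (Lo1_unitmx P1, Lo1_unitmx P1').
pose E := P' *m W *m invmx P.
have Ed : is_diag_mx E.
  apply: (comm_diag_is_diag dI).
  have PD : invmx P *m diag_mx d = T *m invmx P.
    by rewrite -[LHS](mulmxK Pu) -(mulmxA _ _ P) -PT mulKmx.
  by rewrite /E -(mulmxA (P' *m W)) PD mulmxA -(mulmxA P') WT !mulmxA PT'.
have -> : W = invmx P' *m E *m P by rewrite /E -!mulmxA mulKmx// mulVmx// mulmx1.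
by rewrite trig_mul// trig_mul ?trig_inv// is_diag_mx_is_trig.
Qed.

End Factorizations.

(** * Existence and uniqueness of the linearizing variables; profiles *)

Section LinearizingVariables.
Variables (R : realType) (n : nat).
Implicit Types (L U Q M X Y Z : 'M[R]_n) (lam d : 'rV[R]_n) (pi : 'S_n).

Lemma decreasing_row_inj lam : decreasing_row lam -> injective (lam 0).
Proof.
move=> lamD i j; case: (ltngtP i j) => [/lamD|/lamD|/val_inj//].
  by move=> /[swap] ->; rewrite ltxx.
by move=> /[swap] ->; rewrite ltxx.
Qed.

(** Strictly sorted lists with the same members coincide; thus the spectrum determines the row. *)
Lemma decreasing_row_eq lam lam' : decreasing_row lam -> decreasing_row lam' ->
  (forall a, (exists i, lam 0 i = a) <-> (exists i, lam' 0 i = a)) -> lam = lam'.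
Proof.
move=> lamD lamD' E; apply/rowP => i.
have srt (l : 'rV[R]_n) : decreasing_row l ->
    sorted (fun x y : R => y < x) [seq l 0 k | k <- enum 'I_n].
  move=> lD; rewrite sorted_map.
  apply: (sub_sorted (e := fun k k' : 'I_n => (k < k')%N)) => [k k'|].
    exact: lD.
  by have := iota_ltn_sorted 0 n; rewrite -val_enum_ord sorted_map.
have memE (l : 'rV[R]_n) a :
    reflect (exists k, l 0 k = a) (a \in [seq l 0 k | k <- enum 'I_n]).
  apply: (iffP mapP) => [[k _ ->]|[k <-]]; first by exists k.
  by exists k; rewrite ?mem_enum.
have /eq_in_map H : [seq lam 0 k | k <- enum 'I_n] = [seq lam' 0 k | k <- enum 'I_n].
  apply: (irr_sorted_eq (leT := fun x y : R => y < x)).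
  - by move=> x y z xy yz; exact: lt_trans yz xy.
  - by move=> x; exact: ltxx.
  - exact: srt.
  - exact: srt.
  - by move=> a; apply/memE/memE => /E.
by apply: H; rewrite mem_enum.
Qed.

Lemma lo0_trig d Y : lo0 Y -> is_trig_mx (Y + diag_mx d).
Proof.
move=> Y0; apply/is_trig_mxP => i j ij.
by rewrite !mxE Y0 ?(ltnW ij)// -val_eqE ltn_eqF// mulr0n addr0.
Qed.

Lemma lo0_diag d Y i : lo0 Y -> (Y + diag_mx d) i i = d 0 i.
Proof. by move=> Y0; rewrite !mxE Y0// eqxx add0r. Qed.

Lemma trig_lo0 d T : is_trig_mx T -> (forall i, T i i = d 0 i) ->
  lo0 (T - diag_mx d).
Proof.
move=> /is_trig_mxP T0 Td i j; rewrite leq_eqVlt => /predU1P[/val_inj <-|ij].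
  by rewrite !mxE Td eqxx mulr1n subrr.
by rewrite !mxE T0// -val_eqE ltn_eqF// subrr.
Qed.

(** Conjugation by a lower triangular matrix keeps the diagonal of [T]. *)
Lemma trig_conj_lo0 d T L : is_trig_mx T -> (forall i, T i i = d 0 i) ->
  is_trig_mx L -> L \in unitmx -> lo0 (invmx L *m T *m L - diag_mx d).
Proof.
move=> Tt Td Lt Lu; have iLt := trig_inv Lu Lt.
apply: trig_lo0 => [|i]; first by rewrite !trig_mul.
rewrite !trig_mul_diag ?trig_mul// trig_inv_diag// Td mulrAC mulVf ?mul1r//.
exact: (trig_unitmxP Lt Lu).
Qed.

(** [Q] is [T^-1] times [T Q], and leading minors are multiplicative for a lower triangular left
    factor. *)
Lemma Opos_mull T Q : is_trig_mx T -> (forall i, 0 < T i i) ->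
  Q^T *m Q = 1%:M -> GLpos (T *m Q) -> Opos Q.
Proof.
move=> Tt T0 QQ [_ TQ]; split=> // k; have Tu := trig_pos_unitmx Tt T0.
rewrite -/(lead_sub k Q) -[Q](mulKmx Tu) det_lead_sub_mull ?trig_inv//.
apply: mulr_gt0; last exact: TQ.
apply: (trig_lead_minors_pos (trig_inv Tu Tt)).2 => i.
by rewrite trig_inv_diag// invr_gt0.
Qed.

Lemma lin_vars_of_Opos pi lam Q Y : decreasing_row lam -> lo0 Y -> Opos Q ->
  exists Z, lin_vars pi (Q^T *m (Y + diag_perm lam pi) *m Q) (diag_perm lam pi) Y Z.
Proof.
move=> lamD Y0 QO; have [L [U [L1 Up QE]]] := Lo1_Uppos_exists QO.2.
rewrite diag_permE; set d := \row_i _.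
exists (invmx L *m (Y + diag_mx d) *m L - diag_mx d); split.
  by exists lam => //; rewrite diag_permE.
split=> //; split.
  apply: trig_conj_lo0; [exact: lo0_trig| | |exact: Lo1_unitmx].
    by move=> i; exact: lo0_diag.
  by case: L1.
by exists Q, L, U; split=> //; rewrite subrK.
Qed.

Lemma UO_lin_vars pi lam M : decreasing_row lam ->
  UO (diag_perm lam pi) M <-> exists Z, lin_vars pi M (diag_perm lam pi) 0 Z.
Proof.
move=> lamD; split=> [[Q QO ->]|[Z [_ [_ [_ [Q [L [U [QO -> _ _]]]]]]]]].
  have := @lin_vars_of_Opos pi lam Q 0 lamD; rewrite add0r; apply=> // i j _.
  by rewrite mxE.
by exists Q; rewrite ?add0r.
Qed.

(** Writing [X = T Q] turns [X^-1 D X] into [Q^T (T^-1 D T) Q], whose middle factor is [Y + D].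
    Conversely [Y + D = P^-1 D P] with [P] lower unitriangular, and [X = P Q]. *)
Lemma UGL_lin_vars pi lam M : decreasing_row lam ->
  UGL (diag_perm lam pi) M <-> exists Y Z, lin_vars pi M (diag_perm lam pi) Y Z.
Proof.
move=> lamD; split=> [[X [Xu Xp] ->]|[Y [Z [_ [Y0 [_ [Q [L [U [QO -> _ _]]]]]]]]]].
  have [T [Q [Tt T0 QQ XE]]] := lower_orthogonal_exists Xu.
  have Tu := trig_pos_unitmx Tt T0.
  have QO : Opos Q by apply: (Opos_mull Tt T0 QQ); rewrite -XE; split.
  have Qu := Opos_unitmx QO.
  exists (invmx T *m diag_perm lam pi *m T - diag_perm lam pi).
  have -> : invmx X *m diag_perm lam pi *m X =
      Q^T *m (invmx T *m diag_perm lam pi *m T) *m Q.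
    rewrite -ortho_invmx//.
    have -> : invmx X = invmx Q *m invmx T.
      rewrite -[RHS](mulmxK Xu) {2}XE -!mulmxA (mulmxA (invmx T)) mulVmx//.
      by rewrite mul1mx mulKmx// mulmxV.
    by rewrite XE !mulmxA.
  rewrite -{1}[invmx T *m _ *m T](subrK (diag_perm lam pi)).
  apply: lin_vars_of_Opos => //; rewrite diag_permE.
  by apply: trig_conj_lo0; rewrite ?diag_mx_is_trig// => i; rewrite [LHS]mxE eqxx.
rewrite diag_permE; set d := \row_i _; have dI : injective (d 0).
  by move=> i j; rewrite !mxE => /(decreasing_row_inj lamD)/perm_inj.
have [P P1 PE] := trig_diagonalizer (lo0_trig d Y0) (fun i => lo0_diag d i Y0) dI.
have Pu := Lo1_unitmx P1; have Qu := Opos_unitmx QO.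
exists (P *m Q); first split.
- by rewrite unitmx_mul Pu.
- apply/lead_minors_pos_mull; [by case: P1|by case: QO|].
  by apply/trig_lead_minors_pos => [|i]; case: P1 => // _ ->.
have -> : Y + diag_mx d = invmx P *m diag_mx d *m P by rewrite -mulmxA -PE mulKmx.
rewrite -ortho_invmx; last by case: QO.
suff -> : invmx (P *m Q) = invmx Q *m invmx P by rewrite !mulmxA.
have PQu : P *m Q \in unitmx by rewrite unitmx_mul Pu.
rewrite -[RHS](mulmxK PQu) -!mulmxA (mulmxA (invmx P)) mulVmx//.
by rewrite mul1mx mulKmx.
Qed.

Lemma lin_vars_uniq pi M D Y Z D' Y' Z' :
  lin_vars pi M D Y Z -> lin_vars pi M D' Y' Z' -> [/\ D = D', Y = Y' & Z = Z'].
Proof.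
case=> -[lam lamD ->] [Y0 [Z0 [Q [L [U [QO ME [L1 Up QE] ZE]]]]]].
case=> -[lam' lamD' ->] [Y0' [Z0' [Q' [L' [U' [QO' ME' [L1' Up' QE'] ZE']]]]]].
have [Qu Qu'] := (Opos_unitmx QO, Opos_unitmx QO').
move: ME ME' ZE ZE'; rewrite !diag_permE.
set d := \row_i _; set d' := \row_i _ => ME ME' ZE ZE'.
have [Tt Tt'] := (lo0_trig d Y0, lo0_trig d' Y0').
(* The two diagonal parts may differ a priori; the entries of either row are exactly the eigenvalues
   of [M], which forces [lam = lam']. *)
have eigE lam0 Q0 Y1 : Opos Q0 -> lo0 Y1 ->
    M = Q0^T *m (Y1 + diag_mx (\row_i lam0 0 (pi i))) *m Q0 ->
    forall a, eigenvalue M a <-> exists i, lam0 0 i = a.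
  move=> Q0O Y10 M0E a; have Q0u := Opos_unitmx Q0O.
  have QM : Q0 *m M = (Y1 + diag_mx (\row_i lam0 0 (pi i))) *m Q0.
    by rewrite M0E -(ortho_invmx Q0O.1) !mulmxA mulmxV// mul1mx.
  have MQ : invmx Q0 *m (Y1 + diag_mx (\row_i lam0 0 (pi i))) = M *m invmx Q0.
    by apply: (can_inj (mulmxK Q0u)); rewrite mulmxKV// -mulmxA -QM mulKmx.
  have iQ0u : invmx Q0 \in unitmx by rewrite unitmx_inv.
  have T0t := lo0_trig (\row_i lam0 0 (pi i)) Y10.
  split=> [/(intertwine_eigenvalue iQ0u MQ)/(trig_eigenvalueP _ T0t)[i]|[i ia]].
    by rewrite lo0_diag// mxE => ?; exists (pi i).
  apply: (intertwine_eigenvalue Q0u QM); apply/(trig_eigenvalueP _ T0t).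
  by exists ((pi^-1)%g i); rewrite lo0_diag// mxE permKV.
have lamE : lam = lam'.
  apply: decreasing_row_eq => // a.
  by rewrite -(eigE _ _ _ QO Y0 ME) (eigE _ _ _ QO' Y0' ME').
have dE : d' = d by rewrite /d' /d lamE.
rewrite -/d -/d' dE in Tt' ME' ZE' *.
have dI : injective (d 0).
  by move=> i j; rewrite !mxE => /(decreasing_row_inj lamD)/perm_inj.
pose W := Q' *m Q^T.
have WQ : W *m Q = Q' by rewrite /W -(ortho_invmx QO.1) mulmxKV.
have WT : W *m (Y + diag_mx d) = (Y' + diag_mx d) *m W.
  apply: (can_inj (mulmxK Qu)); rewrite -[RHS]mulmxA WQ.
  apply: (can_inj (mulKmx (_ : Q'^T \in unitmx))); first by rewrite unitmx_tr.
  rewrite [RHS]mulmxA -ME' ME /W -(ortho_invmx QO'.1) !mulmxA mulVmx//.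
  by rewrite mul1mx.
have Wt : is_trig_mx W.
  by apply: (trig_intertwine dI Tt Tt') WT => i; exact: lo0_diag.
have WW : W^T *m W = 1%:M.
  by rewrite /W trmx_mul trmxK mulmxA -(mulmxA Q) QO'.1 mulmx1 (mulmx1C QO.1).
have W1 : W = 1%:M.
  apply: ortho_trig_pos => //; apply/(trig_lead_minors_pos Wt).
  by apply/(lead_minors_pos_mull Wt QO.2); rewrite WQ; exact: QO'.2.
have QQ' : Q = Q' by rewrite -WQ W1 mul1mx.
have LL' : L = L' by apply: (Lo1_Uppos_uniq L1 L1' Up Up'); rewrite -QE -QE'.
have YY' : Y = Y'.
  by apply: (addIr (diag_mx d)); move: WT; rewrite W1 mul1mx mulmx1.
split=> //; apply: (addIr (diag_mx d)).
by rewrite ZE ZE' LL' YY'.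
Qed.

(** Entry [(i, j)] of [U M V] involves only entries [(k, l)] of [M] with [i <= k] and [l <= j]; if
    one of these positions is in the profile, so is [(i, j)]. *)
Lemma VM_mul (P : {set 'I_n * 'I_n}) M U V : is_profile P -> is_trig_mx U^T ->
  is_trig_mx V^T -> VM P M -> VM P (U *m M *m V).
Proof.
move=> [S _ PE] /is_trig_mxP U0 /is_trig_mxP V0 /mem_span_delta M0.
apply/mem_span_delta => i j ijP; rewrite mxE big1// => l _.
case: (leqP l j) => [lj|jl]; last first.
  by have := V0 _ _ jl; rewrite mxE => ->; rewrite mulr0.
rewrite mxE big1 ?mul0r// => k _; case: (leqP i k) => [ik|ki]; last first.
  by have := U0 _ _ ki; rewrite mxE => ->; rewrite mul0r.
rewrite M0 ?mulr0//; apply: contra ijP; rewrite PE !inE/=.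
case/existsP => y /andP[yS /andP[ky yl]]; apply/existsP; exists y.
by rewrite yS (leq_trans ik ky) (leq_trans yl lj).
Qed.

(** [Z + D = U M U^-1] has the profile of [M], and it agrees with [Z] below the diagonal. *)
Lemma lin_vars_VM (P : {set 'I_n * 'I_n}) pi M D Y Z : is_profile P -> VM P M ->
  lin_vars pi M D Y Z -> VM P Z.
Proof.
move=> Pp MP [[lam _ ->] [_ [Z0 [Q [L [U [QO ME [L1 Up QE] ZE]]]]]]].
have [Lu Uu] := (Lo1_unitmx L1, Uppos_unitmx Up).
have ZU : Z + diag_perm lam pi = U *m M *m invmx U.
  rewrite ZE ME -(ortho_invmx QO.1); apply: (can_inj (mulmxK Uu)).
  rewrite mulmxKV// -(mulmxA _ L U) -QE !mulmxA; congr (_ *m _ *m _).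
  apply: (can_inj (mulmxK (Opos_unitmx QO))); rewrite mulmxKV ?Opos_unitmx//.
  by rewrite QE mulmxA mulVmx// mul1mx.
have Ut : is_trig_mx (invmx U)^T by rewrite trmx_inv trig_inv ?unitmx_tr//; case: Up.
have /mem_span_delta T0 := VM_mul Pp Up.1 Ut MP.
apply/mem_span_delta => i j ijP; case: (leqP i j) => [|ji]; first exact: Z0.
have := T0 _ _ ijP; rewrite -ZU diag_permE !mxE -val_eqE gtn_eqF//.
by rewrite addr0.
Qed.

End LinearizingVariables.

(** * Calculus of real functions and of matrix curves *)

Section Calculus.
Variable R : realType.
Implicit Types (f g F : R -> R) (a b s t x : R) (J : set R).

Lemma open_left J x : open J -> J x -> exists2 y, J y & y < x.
Proof.
move=> Jo Jx; have /nbhs_ballP[e /= e0 eJ] : nbhs x J by exact: open_nbhs_nbhs.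
exists (x - e / 2); last by rewrite ltrBlDr ltrDl divr_gt0.
apply: eJ; rewrite /ball/= opprB addrC subrK gtr0_norm ?divr_gt0//.
by rewrite ltr_pdivrMr// ltr_pMr// ltr1n.
Qed.

Lemma open_right J x : open J -> J x -> exists2 y, J y & x < y.
Proof.
move=> Jo Jx; have /nbhs_ballP[e /= e0 eJ] : nbhs x J by exact: open_nbhs_nbhs.
exists (x + e / 2); last by rewrite ltrDl divr_gt0.
apply: eJ; rewrite /ball/= opprD addNKr normrN gtr0_norm ?divr_gt0//.
by rewrite ltr_pdivrMr// ltr_pMr// ltr1n.
Qed.

Lemma derive_continuous f (df : R) x : is_derive x (1 : R) f df ->
  {for x, continuous f}.
Proof.
by move=> [fx _]; exact/differentiable_continuous/derivable1_diffP.
Qed.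

Lemma continuous_at_sum (I : Type) (r : seq I) (P : pred I) (h : I -> R -> R) x :
  (forall i, P i -> continuous_at x (h i)) ->
  continuous_at x (fun y => \sum_(i <- r | P i) h i y).
Proof.
move=> hc; elim: r => [|i r IH].
  by under eq_fun do rewrite big_nil; exact: cvg_cst.
under eq_fun do rewrite big_cons; case: ifP => // Pi.
by apply: (@continuousD _ R R (h i)) => //; exact: hc.
Qed.

Lemma derive0_cst f a b :
  (forall x, a < x < b -> is_derive x (1 : R) f 0) ->
  forall x y, a < x < b -> a < y < b -> f x = f y.
Proof.
move=> df x y.
wlog xy : x y / x <= y.
  by move=> H xab yab; case: (leP x y) => [|/ltW] xy; [exact: H|exact/esym/H].
move=> /andP[ax xb] /andP[ay yb].
have sub z : x <= z -> z <= y -> is_derive z (1 : R) f 0.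
  by move=> xz zy; apply: df; rewrite (lt_le_trans ax)//= (le_lt_trans zy).
have [z /[!in_itv]/= /andP[xz zy]||c _] := @MVT_segment R f (fun=> 0) x y xy.
- by apply: sub; exact: ltW.
- apply: continuous_in_subspaceT => z; rewrite inE/= in_itv/= => /andP[xz zy].
  exact: derive_continuous (sub z xz zy).
- by rewrite mul0r => /eqP; rewrite subr_eq0 => /eqP.
Qed.

(** The integral from [a], shifted by a constant to take the value [c] at [s]. *)
Lemma antiderivative_exists f a b s (c : R) :
  (forall x, a <= x <= b -> {for x, continuous f}) -> a < s < b ->
  exists2 F, F s = c & forall x, a < x < b -> is_derive x (1 : R) F (f x).
Proof.
move=> fc asb.
have fi : lebesgue_measure.-integrable `[a, b] (EFin \o f).
  apply: continuous_compact_integrable; first exact: segment_compact.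
  by apply: continuous_in_subspaceT => z; rewrite inE/= in_itv/=; exact: fc.
pose G y := (\int[lebesgue_measure]_(t in [set` `[a, y]]) (f t))%R.
have dG x : a < x < b -> is_derive x (1 : R) G (f x).
  move=> /andP[ax xb].
  have [|dG GE] := continuous_FTC1_closed xb fi ax.
    by apply: fc; rewrite !ltW.
  by split=> //; rewrite -derive1E.
exists (fun x => G x + (c - G s)); first by rewrite addrC subrK.
move=> x axb; have Gx := dG x axb.
by apply: is_derive_eq; rewrite addr0.
Qed.

Lemma is_derive_mxP m n (M : R -> 'M[R]_(m, n)) (dM : 'M[R]_(m, n)) t :
  is_derive t (1 : R) M dM <->
  forall i j, is_derive t (1 : R) (fun x => M x i j) (dM i j).
Proof.
split=> [[Md ME] i j|H].
  split; first by move/derivable_mxP : Md; exact.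
  by rewrite -ME derive_mx// mxE.
have Md : derivable M t 1 by apply/derivable_mxP => i j; have [] := H i j.
split=> //; rewrite derive_mx//; apply/matrixP => i j; rewrite mxE.
by have [] := H i j.
Qed.

Lemma is_derive_mulmx m n l (A : R -> 'M[R]_(m, n)) (B : R -> 'M[R]_(n, l)) dA dB t :
  is_derive t (1 : R) A dA -> is_derive t (1 : R) B dB ->
  is_derive t (1 : R) (fun x => A x *m B x) (dA *m B t + A t *m dB).
Proof.
move=> /is_derive_mxP dAt /is_derive_mxP dBt; apply/is_derive_mxP => i j.
have -> : (fun x => (A x *m B x) i j) =
    \sum_(k < n) ((fun x => A x i k) * (fun x => B x k j)).
  by apply/funext => x; rewrite mxE fct_sumE.
apply: is_derive_eq; rewrite !mxE -big_split/=; apply: eq_bigr => k _.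
by rewrite addrC; congr (_ + _); exact: mulrC.
Qed.

Lemma is_derive_trmx m n (A : R -> 'M[R]_(m, n)) dA t :
  is_derive t (1 : R) A dA -> is_derive t (1 : R) (fun x => (A x)^T) dA^T.
Proof.
move=> /is_derive_mxP dAt; apply/is_derive_mxP => i j; rewrite mxE.
by under eq_fun do rewrite mxE.
Qed.

Lemma derive0_mx_cst m n (A : R -> 'M[R]_(m, n)) a b :
  (forall x, a < x < b -> is_derive x (1 : R) A 0) ->
  forall x y, a < x < b -> a < y < b -> A x = A y.
Proof.
move=> dA x y xab yab; apply/matrixP => i j.
apply: (@derive0_cst (fun z => A z i j) a b) => // z /dA/is_derive_mxP/(_ i j).
by rewrite mxE.
Qed.

(** Serves to show that [p(M)] is continuous along a solution, so the derivative is left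
    unspecified. *)
Lemma derivable_horner_mx n (M : R -> 'M[R]_n.+1) dM (p : {poly R}) t :
  is_derive t (1 : R) M dM ->
  exists dN, is_derive t (1 : R) (fun x => horner_mx (M x) p) dN.
Proof.
move=> Mt; elim/poly_ind: p => [|p c [dN Nt]].
  by exists 0; under eq_fun do rewrite rmorph0; exact: is_derive_cst.
have := is_derive_mulmx Nt Mt; move: (_ + _) => dP Pt; exists (dP + 0).
have -> : (fun x => horner_mx (M x) (p * 'X + c%:P)) =
    (fun x => horner_mx (M x) p *m M x) + cst c%:M.
  by apply/funext => x; rewrite rmorphD rmorphM/= horner_mx_X horner_mx_C.
by apply: is_deriveD; exact: is_derive_cst.
Qed.

End Calculus.

(** * Linear systems [v' = v B] with upper triangular [B] *)

Section UpperTriangularODE.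
Variables (R : realType) (n : nat) (J : set R) (B : R -> 'M[R]_n).
Hypotheses (Jo : open J) (Ji : is_interval J).
Hypothesis Bc : forall x, J x -> forall i j, {for x, continuous (fun y => B y i j)}.
Hypothesis Bu : forall x, is_trig_mx (B x)^T.

Lemma row_mul_upper (v : 'rV[R]_n) x j :
  (v *m B x) 0 j = \sum_(i < n | (i <= j)%N) v 0 i * B x i j.
Proof.
rewrite mxE [RHS]big_mkcond; apply: eq_bigr => i _; case: leqP => // ji.
by have /is_trig_mxP/(_ j i ji) := Bu x; rewrite mxE => ->; rewrite mulr0.
Qed.

Lemma segment_continuous a b : J a -> J b -> forall i j x, a <= x <= b ->
  {for x, continuous (fun y => B y i j)}.
Proof. by move=> Ja Jb i j x axb; apply: Bc; exact: (Ji Ja Jb). Qed.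

(* Entry [k] satisfies a scalar linear equation whose inhomogeneity involves the
   previous entries only; each step shrinks the interval, because antiderivatives
   are taken on an open interval with continuity up to its ends. *)
Lemma upper_ode_row_exists (r : 'rV[R]_n) s k : forall a b, J a -> J b -> a < s < b ->
  exists2 v : R -> 'rV[R]_n, v s = r & forall x, a < x < b ->
    forall j : 'I_n, (j < k)%N ->
    is_derive x (1 : R) (fun y => v y 0 j) ((v x *m B x) 0 j).
Proof.
elim: k => [|k IH] a b Ja Jb /andP[asx sb]; first by exists (fun=> r).
have [a0 Ja0 a0a] := open_left Jo Ja; have [b0 Jb0 bb0] := open_right Jo Jb.
have asb0 : a0 < s < b0 by rewrite (lt_trans a0a)// (lt_trans sb).
have [v vs dv] := IH _ _ Ja0 Jb0 asb0.
have [kn|nk] := ltnP k n; last first.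
  exists v => // x /andP[ax xb] j jk.
  apply: dv; last exact: leq_trans (ltn_ord j) nk.
  by rewrite (lt_trans a0a)// (lt_trans xb).
pose k' := Ordinal kn.
(* Variation of constants: the new entry is [exp(F) G], where [F' = B k k], [F(s) = 0], and [G' = g]
   with [G(s)] the prescribed initial value. *)
have [F Fs dF] := antiderivative_exists 0 (@segment_continuous _ _ Ja0 Jb0 k' k') asb0.
pose g x := (\sum_(i < n | (i < k)%N) v x 0 i * B x i k') * expR (- F x).
have gc x : a <= x <= b -> {for x, continuous g}.
  move=> /andP[ax xb].
  have x0 : a0 < x < b0 by rewrite (lt_le_trans a0a)// (le_lt_trans xb).
  apply: (@continuousM R R); last first.
    have dFx := dF x x0.
    by apply: derive_continuous.
  apply: continuous_at_sum => i ik; apply: (@continuousM R R).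
    exact: derive_continuous (dv x x0 i ik).
  by apply: (segment_continuous Ja Jb); rewrite ax.
have asb : a < s < b by rewrite asx.
have [G Gs dG] := antiderivative_exists (r 0 k') gc asb.
exists (fun x => \row_j if j == k' then expR (F x) * G x else v x 0 j).
  apply/rowP => j; rewrite mxE Fs Gs expR0 mul1r vs.
  by case: eqP => [->|].
move=> x /andP[ax xb] j; rewrite ltnS leq_eqVlt => jk.
have xab : a < x < b by rewrite ax.
have xab0 : a0 < x < b0 by rewrite (lt_trans a0a)// (lt_trans xb).
have sumE : \sum_(i < n | (i < k)%N) (\row_j0 if j0 == k' then expR (F x) * G x
    else v x 0 j0) 0 i * B x i j = \sum_(i < n | (i < k)%N) v x 0 i * B x i j.
  by apply: eq_bigr => i ik; rewrite mxE -val_eqE/= ltn_eqF.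
case/predU1P : jk => [jk|jk]; last first.
  rewrite row_mul_upper; under eq_fun do rewrite mxE -val_eqE/= ltn_eqF//.
  have := dv x xab0 j jk; rewrite row_mul_upper.
  congr is_derive; apply: eq_bigr => i ij.
  by rewrite mxE -val_eqE/= ltn_eqF ?(leq_ltn_trans ij jk).
have {jk} jE : j = k' by exact/val_inj.
rewrite jE in sumE *.
rewrite row_mul_upper (bigD1 k')//= mxE eqxx.
rewrite (eq_bigl (fun i : 'I_n => (i < k)%N)); last first.
  by move=> i; rewrite ltn_neqAle andbC.
rewrite sumE; under eq_fun do rewrite mxE eqxx.
have dFx := dF x xab0; have dGx := dG x xab.
apply: is_derive_eq; rewrite /g.
rewrite addrC /GRing.scale/=; congr (_ + _).
  by rewrite mulrCA -expRD subrr expR0 mulr1.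
by rewrite mulrCA mulrA.
Qed.

(** With all earlier entries zero, entry [k] solves [y' = B k k y], so it is multiplied by the
    exponential of an integral. *)
Lemma upper_ode_scale (v : R -> 'rV[R]_n) a b (k : 'I_n) : J a -> J b ->
  (forall x, a < x < b -> forall j : 'I_n,
    is_derive x (1 : R) (fun y => v y 0 j) ((v x *m B x) 0 j)) ->
  (forall x, a < x < b -> forall j : 'I_n, (j < k)%N -> v x 0 j = 0) ->
  forall s t, a < s < b -> a < t < b ->
  exists2 c : R, 0 < c & v t 0 k = c * v s 0 k.
Proof.
move=> Ja Jb dv v0 s t asb atb.
have [F Fs dF] := antiderivative_exists 0 (@segment_continuous _ _ Ja Jb k k) asb.
exists (expR (F t)); first exact: expR_gt0.
pose h x := v x 0 k * expR (- F x).
suff : h t = h s.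
  rewrite /h Fs oppr0 expR0 mulr1 => <-.
  by rewrite mulrCA -expRD subrr expR0 mulr1.
apply: (derive0_cst _ atb asb) => x axb.
have dvx := dv x axb k; have dFx := dF x axb.
apply: is_derive_eq.
rewrite row_mul_upper (bigD1 k)//= big1 => [|i /andP[ik iNk]]; last first.
  by rewrite v0 ?mul0r// ltn_neqAle iNk.
rewrite addr0 /GRing.scale/=; ring.
Qed.

(** Entries vanish one after another, each being a multiple of its value at [s]. For [k] equal to
    the size this is uniqueness of the zero solution. *)
Lemma upper_ode_zero (v : R -> 'rV[R]_n) a b k s : J a -> J b ->
  (forall x, a < x < b -> forall j : 'I_n,
    is_derive x (1 : R) (fun y => v y 0 j) ((v x *m B x) 0 j)) ->
  a < s < b -> (forall j : 'I_n, (j < k)%N -> v s 0 j = 0) ->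
  forall x, a < x < b -> forall j : 'I_n, (j < k)%N -> v x 0 j = 0.
Proof.
move=> Ja Jb dv asb; elim: k => // k IH vs0 x axb j.
have {}IH := IH (fun j jk => vs0 j (leqW jk)).
rewrite ltnS leq_eqVlt => /predU1P[jk|]; last exact: IH.
rewrite -jk in IH; have [c _ ->] := upper_ode_scale Ja Jb dv IH asb axb.
by rewrite vs0 ?mulr0// jk.
Qed.

(** Row [i] starts at the unit vector [e_i]: the zeros before position [i] persist, and the entry at
    [i] stays a positive multiple of 1. *)
Lemma upper_ode_exists s a b : J a -> J b -> a < s < b ->
  exists U : R -> 'M[R]_n, [/\ U s = 1%:M,
    forall x, a < x < b -> is_derive x (1 : R) U (U x *m B x) &
    forall x, a < x < b -> Uppos (U x)].
Proof.
move=> Ja Jb asb.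
have /fin_all_exists[v vP] (i : 'I_n) : exists v : R -> 'rV[R]_n,
    v s = delta_mx 0 i /\ forall x, a < x < b -> forall j : 'I_n,
    is_derive x (1 : R) (fun y => v y 0 j) ((v x *m B x) 0 j).
  have [v vs dv] := upper_ode_row_exists (delta_mx 0 i) n Ja Jb asb.
  by exists v; split=> // x axb j; apply: dv.
have v0 (i : 'I_n) x : a < x < b -> forall j : 'I_n, (j < i)%N -> v i x 0 j = 0.
  have [vs dv] := vP i; apply: (upper_ode_zero Ja Jb dv asb) => j ji.
  by rewrite vs mxE eqxx -val_eqE/= ltn_eqF.
exists (fun x => \matrix_i v i x); split.
- by apply/row_matrixP => i; rewrite rowK row1; have [] := vP i.
- move=> x axb; apply/is_derive_mxP => i j.
  have [_ /(_ x axb j)] := vP i.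
  have -> : (v i x *m B x) 0 j = ((\matrix_i0 v i0 x) *m B x) i j.
    by rewrite !mxE; apply: eq_bigr => l _; rewrite mxE.
  by under [X in _ -> is_derive _ _ X _]eq_fun do rewrite mxE.
- move=> x axb; split=> [|i].
    by apply/is_trig_mxP => i j ij; rewrite !mxE v0.
  have [vs dv] := vP i.
  have [c c0 E] := upper_ode_scale Ja Jb dv (v0 i) asb axb.
  by rewrite mxE E vs mxE !eqxx mulr1.
Qed.

End UpperTriangularODE.

(** * Integration of the Toda flow by upper triangular conjugation *)

Section TodaFlow.
Variables (R : realType) (n : nat) (p : {poly R}).
Implicit Types (M : R -> 'M[R]_n.+1) (J : set R).

Lemma Pi_o_tr m (A : 'M[R]_m) : (Pi_o A)^T = - Pi_o A.
Proof.
rewrite !Pi_oE; apply/matrixP => i j; rewrite !mxE.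
by case: ltngtP => _; rewrite ?opprK ?oppr0.
Qed.

Lemma Pi_o_sub_upper m (A : 'M[R]_m) : is_trig_mx (Pi_o A - A)^T.
Proof.
by rewrite Pi_oE; apply/is_trig_mxP => i j ij; rewrite !mxE ij subrr.
Qed.

(** Lets the skew-symmetric part of [p(M)] be replaced by minus its upper triangular remainder in
    the Toda equation. *)
Lemma lie_horner_mx (A B : 'M[R]_n.+1) (q : {poly R}) :
  lie A (B - horner_mx A q) = lie A B.
Proof.
have AqA : A *m horner_mx A q = horner_mx A q *m A.
  exact: comm_mx_horner.
by rewrite /lie mulmxBr mulmxBl AqA opprB addrA addrNK.
Qed.

(** The exponential of [x p(diag d)], written entrywise. *)
Definition expm_diag (d : 'rV[R]_n.+1) (x : R) : 'M[R]_n.+1 :=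
  diag_mx (\row_i expR (x * p.[d 0 i])).

Lemma expm_diag_derive d s x :
  is_derive x (1 : R) (fun y => expm_diag d (y - s))
    (expm_diag d (x - s) *m horner_mx (diag_mx d) p).
Proof.
apply/is_derive_mxP => i j; rewrite horner_mx_diag mul_mx_diag !mxE.
under eq_fun do rewrite !mxE.
case: eqP => [->|_]; last by rewrite mulr0n mul0r; exact: is_derive_cst.
rewrite mulr1n; under eq_fun do rewrite mulr1n.
apply: is_derive_eq.
by rewrite scaler0 add0r subr0 /GRing.scale/= mulr1.
Qed.

(** As [X] diagonalizes [M s], the conjugate by [X] of a diagonal exponential is
    [exp((t - s) p(M s))], and no general matrix exponential has to be defined. *)
Lemma toda_factorization J M s t (X : 'M[R]_n.+1) (d : 'rV[R]_n.+1) :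
  open J -> is_interval J -> toda_solution p J M -> J s -> J t ->
  X \in unitmx -> M s = invmx X *m diag_mx d *m X ->
  exists2 U, Uppos U & M t = invmx U *m M s *m U /\
    (let O := invmx X *m expm_diag d (t - s) *m X *m U in O^T *m O = 1%:M).
Proof.
move=> Jo Ji MJ Js Jt Xu Ms.
(* Minus the upper triangular part of [p(M)]; the flow becomes [M' = M B - B M]. *)
pose B x := Pi_o (horner_mx (M x) p) - horner_mx (M x) p.
have Bu x : is_trig_mx (B x)^T by exact: Pi_o_sub_upper.
have Bc x : J x -> forall i j, {for x, continuous (fun y => B y i j)}.
  move=> Jx i j; have [dN /is_derive_mxP dNx] := derivable_horner_mx p (MJ x Jx).
  have ddN i' j' := dNx i' j'.
  apply: (@derive_continuous _ _ (((if (j < i)%N then dN i j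
    else if (i < j)%N then - dN j i else 0)) - dN i j)).
  have -> : (fun y => B y i j) = (fun y => if (j < i)%N then horner_mx (M y) p i j
      else if (i < j)%N then - horner_mx (M y) p j i else 0) -
      (fun y => horner_mx (M y) p i j).
    by apply/funext => y; rewrite /B Pi_oE !mxE.
  apply: is_deriveB; case: ltngtP => _; first exact: ddN.
    exact: (is_deriveN (ddN j i)).
  exact: is_derive_cst.
have [a Ja /andP[as_ at_]] : exists2 a, J a & (a < s) && (a < t).
  have [a Ja asb] := open_left Jo Js; have [a' Ja' at'] := open_left Jo Jt.
  case: (leP a a') => aa'; first by exists a; rewrite // asb (le_lt_trans aa').
  by exists a'; rewrite // at' (lt_trans aa').
have [b Jb /andP[sb tb]] : exists2 b, J b & (s < b) && (t < b).
  have [b Jb sb] := open_right Jo Js; have [b' Jb' tb'] := open_right Jo Jt.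
  case: (leP b' b) => bb'; first by exists b; rewrite // sb (lt_le_trans tb').
  by exists b'; rewrite // tb' (lt_trans sb).
have asb : a < s < b by rewrite as_.
have atb : a < t < b by rewrite at_.
have abJ x : a < x < b -> J x.
  by move=> /andP[ax xb]; apply: (Ji _ _ Ja Jb); rewrite !ltW.
have [U [Us dU Up]] := upper_ode_exists Jo Ji Bc Bu Ja Jb asb.
have dM x : a < x < b -> is_derive x (1 : R) M (M x *m B x - B x *m M x).
  by move=> axb; have := MJ x (abJ x axb); rewrite -(lie_horner_mx _ _ p).
have UM x : a < x < b -> U x *m M x = M s *m U x.
  (* The defect [V] vanishes at [s] and satisfies [V' = V B], so each of its rows is zero by
     uniqueness. *)
  pose V y := U y *m M y - M s *m U y.
  have dV y : a < y < b -> is_derive y (1 : R) V (V y *m B y).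
    move=> ayb; have := is_derive_mulmx (dU y ayb) (dM y ayb).
    have := is_derive_mulmx (is_derive_cst (M s) y (1 : R)) (dU y ayb).
    move=> d1 d2; apply: (is_derive_eq (is_deriveB d2 d1)).
    rewrite /V mul0mx add0r /cst; move: (B y) => By.
    rewrite mulmxBl mulmxBr !mulmxA; congr (_ - _).
    by rewrite addrC addrNK.
  move=> axb; apply/eqP; rewrite -subr_eq0 -/(V x); apply/eqP/matrixP => i j.
  have -> : V x i j = row i (V x) 0 j by rewrite [RHS]mxE.
  rewrite [RHS]mxE; move: j (ltn_ord j).
  apply: (upper_ode_zero (v := fun y => row i (V y)) Ji Bc Bu Ja Jb _ asb) axb.
    move=> y ayb k; have /is_derive_mxP/(_ i k) := dV y ayb.
    have -> : (row i (V y) *m B y) 0 k = (V y *m B y) i k.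
      by rewrite -row_mul [LHS]mxE.
    by under [X in _ -> is_derive _ _ X _]eq_fun do rewrite [row i _ _ _]mxE.
  by move=> k _; rewrite mxE /V Us mul1mx mulmx1 subrr mxE.
have MU x : a < x < b -> M x = invmx (U x) *m M s *m U x.
  by move=> axb; rewrite -mulmxA -UM// mulKmx// Uppos_unitmx//; exact: Up.
exists (U t); [exact: Up|split; first exact: MU].
pose F x := invmx X *m expm_diag d (x - s) *m X.
pose O x := F x *m U x.
have dF x : is_derive x (1 : R) F (F x *m horner_mx (M s) p).
  apply: (is_derive_eq (is_derive_mulmx (is_derive_mulmx
    (is_derive_cst (invmx X) x (1 : R)) (expm_diag_derive d s x))
    (is_derive_cst X x (1 : R)))); rewrite mul0mx add0r mulmx0 addr0.
  by rewrite /F Ms horner_mx_uconjC// !mulmxA mulmxK.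
have dO x : a < x < b -> is_derive x (1 : R) O (O x *m Pi_o (horner_mx (M x) p)).
  move=> axb; apply: (is_derive_eq (is_derive_mulmx (dF x) (dU x axb))).
  rewrite /O -!mulmxA -mulmxDr; congr (_ *m _).
  have Uu : U x \in unitmx by apply: Uppos_unitmx; exact: Up.
  (* Moving [U] past [p(M s)] gives [O' = O (p(M) + B)], and [p(M) + B] is the skew-symmetric
     part. *)
  have -> : horner_mx (M s) p *m U x = U x *m horner_mx (M x) p.
    by rewrite [in RHS](MU x axb) horner_mx_uconjC// !mulmxA mulmxV// mul1mx.
  by rewrite -!mulmxDr /B [X in _ *m (_ *m (_ *m X)) = _]addrC subrK.
(* Since [O' = O S] with [S] skew-symmetric, it is [O O^T] whose derivative [O (S + S^T) O^T]
   vanishes. *)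
suff : O t *m (O t)^T = 1%:M by exact: mulmx1C.
transitivity (O s *m (O s)^T); last first.
  rewrite /O /F Us mulmx1 subrr (_ : expm_diag d 0 = 1%:M) ?mulmx1 ?mulVmx//.
    by rewrite trmx1 mulmx1.
  by apply/matrixP => i j; rewrite !mxE mul0r expR0.
apply: (derive0_mx_cst (A := fun x => O x *m (O x)^T) _ atb asb) => x axb.
apply: (is_derive_eq (is_derive_mulmx (dO x axb) (is_derive_trmx (dO x axb)))).
by rewrite (trmx_mul (O x)) Pi_o_tr mulNmx mulmxN mulmxA subrr.
Qed.

End TodaFlow.

(** * Evolution of the linearizing variables *)

Section TodaLinearization.
Variables (R : realType) (n : nat) (p : {poly R}).
Implicit Types (M : R -> 'M[R]_n.+1) (J : set R) (d lam : 'rV[R]_n.+1).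

Lemma expm_diagN d x : expm_diag p d x *m expm_diag (- p) d x = 1%:M.
Proof.
apply/matrixP => i j; rewrite mul_mx_diag !mxE; case: eqP => [->|_].
  by rewrite mulr1n hornerN mulrN -expRD subrr expR0.
by rewrite mulr0n mul0r.
Qed.

Lemma expm_diag0 (q : {poly R}) d : expm_diag q d 0 = 1%:M.
Proof. by apply/matrixP => i j; rewrite !mxE mul0r expR0. Qed.

Lemma expm_diag_comm (q : {poly R}) d x :
  expm_diag q d x *m diag_mx d = diag_mx d *m expm_diag q d x.
Proof. exact: diag_mxC. Qed.

(** The explicit solution in the variables; the conjugation by [U] is recorded too, for the
    transport of profiles. *)
Lemma toda_lin_vars J M s t (pi : 'S_n.+1) lam (Y Z : 'M[R]_n.+1) :
  open J -> is_interval J -> toda_solution p J M -> J s -> J t ->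
  lin_vars pi (M s) (diag_perm lam pi) Y Z ->
  let d := \row_i lam 0 (pi i) in
  lin_vars pi (M t) (diag_perm lam pi) Y
    (expm_diag p d (t - s) *m Z *m expm_diag (- p) d (t - s)) /\
  exists2 U, Uppos U & M t = invmx U *m M s *m U.
Proof.
move=> Jo Ji MJ Js Jt + d.
case=> -[lam0 lamD0 lam0E] [Y0 [Z0 [Q0 [L0 [U0 [QO Ms [L01 U0p Q0E] ZE]]]]]].
(* The decreasing row supplied by [lin_vars] has the same permuted diagonal as [lam]. *)
have dI : injective (d 0).
  have dE : d = \row_i lam0 0 (pi i).
    apply/rowP => i; move: lam0E; rewrite !diag_permE => /matrixP/(_ i i).
    by rewrite !mxE eqxx !mulr1n.
  by move=> i j; rewrite dE !mxE => /(decreasing_row_inj lamD0)/perm_inj.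
have Q0u := Opos_unitmx QO; have L0u := Lo1_unitmx L01.
rewrite diag_permE -/d in Ms ZE *.
set T := Y + diag_mx d in Ms ZE.
have [P P1 PT] : exists2 P, Lo1 P & P *m T = diag_mx d *m P.
  by apply: trig_diagonalizer dI => [|i]; [exact: lo0_trig|exact: lo0_diag].
have Pu := Lo1_unitmx P1; have [[Pt Pd] [L0t L0d]] := (P1, L01).
have Xu : P *m Q0 \in unitmx by rewrite unitmx_mul Pu.
have iX : invmx (P *m Q0) = invmx Q0 *m invmx P.
  rewrite -[RHS](mulmxK Xu) -!mulmxA (mulmxA (invmx P)) mulVmx//.
  by rewrite mul1mx mulKmx.
have Q0M : Q0 *m M s = T *m Q0.
  by rewrite Ms -(ortho_invmx QO.1) !mulmxA mulmxV// mul1mx.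
have MsX : M s = invmx (P *m Q0) *m diag_mx d *m (P *m Q0).
  rewrite -mulmxA (mulmxA (diag_mx d)) -PT -mulmxA -Q0M iX.
  by rewrite -!mulmxA !mulKmx.
have [U Up [Mt /= OO]] := toda_factorization Jo Ji MJ Js Jt Xu MsX.
have Uu := Uppos_unitmx Up.
split; last by exists U.
set E := expm_diag p d (t - s) in OO *.
set E' := expm_diag (- p) d (t - s).
have EE' : E *m E' = 1%:M by exact: expm_diagN.
have E'E : E' *m E = 1%:M by exact: mulmx1C.
have [[Et E0] [Et' E0']] : Uppos E /\ Uppos E'.
  by split; apply: diag_Uppos => i; rewrite mxE expR_gt0.
have Etr : is_trig_mx E by exact: diag_mx_is_trig.
have Etr' : is_trig_mx E' by exact: diag_mx_is_trig.
(* [K] is [exp((t - s) p(T))], because [P] diagonalizes [T]. *)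
have [K KE] : exists K, K = invmx P *m E *m P by eexists.
have KT : K *m T = T *m K.
  have PD : invmx P *m diag_mx d = T *m invmx P.
    by rewrite -[LHS](mulmxK Pu) -(mulmxA _ _ P) -PT mulKmx.
  by rewrite KE -mulmxA PT !mulmxA -PD -!mulmxA (mulmxA E) expm_diag_comm -!mulmxA.
have Kt : is_trig_mx K by rewrite KE trig_mul// trig_mul// trig_inv.
have Kd i : K i i = E i i.
  rewrite KE trig_mul_diag// ?trig_mul ?trig_inv// trig_mul_diag ?trig_inv//.
  by rewrite trig_inv_diag// Pd invr1 mul1r mulr1.
have Kp : lead_minors_pos K.
  by apply/(trig_lead_minors_pos Kt) => i; rewrite Kd.
have QE : Q0 *m (invmx (P *m Q0) *m E *m (P *m Q0) *m U) = K *m Q0 *m U.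
  by rewrite iX KE !mulmxA mulmxV// mul1mx.
have [Q QKE] : exists Q, Q = K *m Q0 *m U by eexists.
rewrite -QKE in QE.
have QQ : Q^T *m Q = 1%:M.
  rewrite -QE; move: (_ *m U) OO => O OO.
  by rewrite trmx_mul -mulmxA (mulmxA _ Q0) QO.1 mul1mx.
have QOpos : Opos Q.
  split=> //; have KQ := (lead_minors_pos_mull Kt QO.2).2 Kp.
  by rewrite QKE; exact: (lead_minors_pos_mulr Up.1 KQ).2 (Uppos_lead_minors_pos Up).
have QM : Q *m M t = T *m Q.
  by rewrite Mt QKE !mulmxA mulmxK// -(mulmxA K) Q0M !mulmxA KT.
split; first by exists lam0; rewrite // -lam0E diag_permE.
split=> //; split.
  move=> i j ij; rewrite mul_mx_diag mul_diag_mx mxE [X in X * _]mxE.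
  by rewrite Z0// mulr0 mul0r.
(* [K] has the diagonal of [E] and [L0] has ones, so the factor [E'], the inverse of [E], restores
   the unit diagonal. *)
exists Q, (K *m L0 *m E'), (E *m U0 *m U); split=> //.
- by rewrite -mulmxA -QM -(ortho_invmx QQ) mulKmx// Opos_unitmx.
- split.
  + split=> [|i]; first by rewrite !trig_mul.
    rewrite !trig_mul_diag ?trig_mul// L0d mulr1 Kd.
    by rewrite -trig_mul_diag// EE' mxE eqxx.
  + by apply: Uppos_mul => //; apply: Uppos_mul.
  + rewrite QKE Q0E !mulmxA; congr (_ *m _).
    by rewrite -!mulmxA (mulmxA E') E'E mul1mx.
- have Lu : K *m L0 *m E' \in unitmx.
    rewrite !unitmx_mul L0u (trig_pos_unitmx Kt) ?(Uppos_unitmx (conj Et' E0'))//.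
    by move=> i; rewrite Kd.
  (* After multiplication by the new lower factor both sides equal [T K L0 E'], since [E'] commutes
     with the diagonal part and [K] with [T]. *)
  apply: (can_inj (mulKmx Lu)); rewrite -(mulmxA (invmx _)) mulKVmx//.
  rewrite mulmxDr -!mulmxA (mulmxA E' E) E'E mul1mx /E' expm_diag_comm -/E'.
  rewrite -/T -!mulmxDr -mulmxDl ZE -!mulmxA mulKVmx//.
  by rewrite !mulmxA KT.
Qed.

Lemma toda_linear_of_lin_vars pi (A : set 'M[R]_n.+1) : toda_linear p pi A.
Proof.
move=> J M Dpi Y Z Jo Ji MJ _ lv t Jt.
have [[lam lamD DE] _] := lv t Jt.
set d := \row_i lam 0 (pi i).
(* The reference time is [t] itself, so the exponentials are the identity at the point of
   differentiation. Uniqueness identifies the given variables with the explicit ones. *)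
have key x : J x -> [/\ Dpi x = Dpi t, Y x = Y t &
    Z x = expm_diag p d (x - t) *m Z t *m expm_diag (- p) d (x - t)].
  move=> Jx; have := lv t Jt; rewrite DE => lvt.
  have [lvx _] := toda_lin_vars Jo Ji MJ Jt Jx lvt.
  exact: lin_vars_uniq (lv x Jx) lvx.
have near_J (F G : R -> 'M[R]_n.+1) dG : (forall x, J x -> F x = G x) ->
    is_derive t (1 : R) G dG -> is_derive t (1 : R) F dG.
  move=> FG; apply: near_eq_is_derive; near=> x; apply/esym/FG.
  by near: x; exact: open_nbhs_nbhs.
split.
- apply: near_J (is_derive_cst (Dpi t) t (1 : R)) => x Jx.
  by have [] := key x Jx.
- apply: near_J (is_derive_cst (Y t) t (1 : R)) => x Jx.
  by have [] := key x Jx.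
- apply: near_J => [x Jx|]; first by have [_ _ ->] := key x Jx.
  apply: (is_derive_eq (is_derive_mulmx (is_derive_mulmx
    (expm_diag_derive p d t t) (is_derive_cst (Z t) t (1 : R)))
    (expm_diag_derive (- p) d t t))).
  (* The product rule leaves [p(D) Z - Z p(D)]. *)
  rewrite subrr !expm_diag0 /cst !mul1mx addr0 mulmx1.
  by rewrite rmorphN DE diag_permE /lie mulmxN mulNmx opprK addrC.
Unshelve. all: by end_near. Qed.

End TodaLinearization.

(** * Invariance and linearization on the profile sets *)

Theorem corollary3p13 (R : realType) (n : nat) (lam : 'rV[R]_n.+1)
    (pi : 'S_n.+1) (P : {set 'I_n.+1 * 'I_n.+1}) (p : {poly R}) :
  decreasing_row lam -> is_profile P ->
  let Dpi := diag_perm lam pi in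
  let AO := UO Dpi `&` VS P in
  let AGL := UGL Dpi `&` VM P in
  [/\ toda_invariant p AO /\ toda_invariant p AGL,
      lin_vars_defined pi AO /\ lin_vars_defined pi AGL,
      forall M D' Y Z, AO M -> lin_vars pi M D' Y Z ->
        [/\ D' = Dpi, Y = 0 & (lo0 (n := n.+1) `&` VM P) Z],
      forall M D' Y Z, AGL M -> lin_vars pi M D' Y Z ->
        [/\ D' = Dpi, lo0 Y & (lo0 (n := n.+1) `&` VM P) Z] &
      toda_linear p pi AO /\ toda_linear p pi AGL].
Proof.
move=> lamD Pp Dpi AO AGL.
have VM_flow M U : VM P M -> Uppos U -> VM P (invmx U *m M *m U).
  move=> MP Up; apply: VM_mul => //; last by case: Up.
  by rewrite trmx_inv trig_inv ?unitmx_tr ?Uppos_unitmx//; case: Up.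
have UO_sym M : UO Dpi M -> M^T = M.
  case=> Q _ ->.
  by rewrite /Dpi diag_permE !trmx_mul trmxK tr_diag_mx mulmxA.
have uniq_vars M : (exists Y Z, lin_vars pi M Dpi Y Z) ->
    exists! v : 'M[R]_n.+1 * 'M[R]_n.+1 * 'M[R]_n.+1, lin_vars pi M v.1.1 v.1.2 v.2.
  case=> Y [Z lv]; exists (Dpi, Y, Z); split=> // -[[D' Y'] Z'] /= lv'.
  by have [-> -> ->] := lin_vars_uniq lv lv'.
split.
- split=> J M Jo Ji MJ s t Js Jt [Us Ps].
    (* Membership in [UO Dpi] means variables with diagonal part [Dpi] and [Y = 0], and the flow
       preserves both. *)
    have [Z lv] := (UO_lin_vars pi (M s) lamD).1 Us.
    have [lvt [U Up Mt]] := toda_lin_vars Jo Ji MJ Js Jt lv.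
    have Ut : UO Dpi (M t) by apply/(UO_lin_vars pi _ lamD); eexists; exact: lvt.
    split=> //; split; last exact: UO_sym.
    by rewrite Mt; apply: VM_flow => //; case: Ps.
  have [Y [Z lv]] := (UGL_lin_vars pi (M s) lamD).1 Us.
  have [lvt [U Up Mt]] := toda_lin_vars Jo Ji MJ Js Jt lv.
  split; first by apply/(UGL_lin_vars pi _ lamD); exists Y; eexists; exact: lvt.
  by rewrite Mt; exact: VM_flow.
- split=> M [UM _]; apply: uniq_vars; last exact/(UGL_lin_vars pi _ lamD).
  by exists 0; exact/(UO_lin_vars pi _ lamD).
- move=> M D' Y Z [UM [MP _]] lv.
  have [Z' lv'] := (UO_lin_vars pi M lamD).1 UM.
  have [-> -> _] := lin_vars_uniq lv lv'; split=> //.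
  by split; [case: lv => _ [_ []]|exact: lin_vars_VM lv].
- move=> M D' Y Z [UM MP] lv.
  have [Y' [Z' lv']] := (UGL_lin_vars pi M lamD).1 UM.
  have [-> _ _] := lin_vars_uniq lv lv'; split=> //; first by case: lv => _ [].
  by split; [case: lv => _ [_ []]|exact: lin_vars_VM lv].
- by split; exact: toda_linear_of_lin_vars.
Qed.
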